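(* Let $k\geq 5$ and $1\leq m\leq \sqrt{k}$ be integers, and let $\mathcal{F}$ be a finite intersection-closed family of finite sets with $|\mathcal{F}|\geq 2$. Then there is an $i\in\bigcup_{A\in\mathcal{F}}A$ such that \[\frac{\sum_{A\in\mathcal{F}:\,i\notin A}\left(\frac{m}{k}\right)^{|A|}}{\sum_{A\in\mathcal{F}}\left(\frac{m}{k}\right)^{|A|}}\geq\frac{1}{2}.\]
   Context: A family $\mathcal{F}$ of sets is intersection-closed if $A\cap B\in\mathcal{F}$ for all $A,B\in\mathcal{F}$. *)

(* Defs.v *)
From mathcomp Require Import all_boot all_order all_algebra.
From mathcomp Require Import finmap.
From mathcomp Require Import reals.

Set Implicit Arguments.
Unset Strict Implicit.
Unset Printing Implicit Defensive.

Local Open Scope fset_scope.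

Definition intersection_closed (T : choiceType) (F : {fset {fset T}}) : Prop :=
  forall A B : {fset T}, A \in F -> B \in F -> A `&` B \in F.

(* Main.v *)
(** An entropy argument in the style of Gilmer.  Put [lam = m / k <= 2 / 5] and
    let [A], [B] be independent random members of [F] with law proportional to
    [lam ^ #|A|].  This law maximizes [H(A) + ln lam * E#|A|] among all laws on
    [F], in particular it does at least as well as the law of [A `&` B].  Let
    [m_x] be the probability that [x] belongs to [A], and suppose that every
    [m_x] exceeds 1/2.  Passing from [A] to [A `&` B] increases the term
    [ln lam * E#|A|] by [- ln lam * sum_x m_x (1 - m_x)], whereas the entropy
    decreases by at most [e^-1 * sum_x (1 - m_x)]: revealing the elements one at
    a time, with conditional probabilities [p] and [q] of [x \in A], [x \in B]
    and [eta u = - u ln u], one has [eta (p q) = q eta p + p eta q] and, by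
    concavity, [eta (1 - p q) >= (q eta (1 - p) + p eta (1 - q)) / 2], while
    [eta (1 - p) <= 1/e].  Since [- ln lam / 2 > 1/e], this contradicts
    maximality. *)
Require Import Defs.
From mathcomp Require Import all_boot all_order all_algebra.
From mathcomp Require Import finmap.
From mathcomp Require Import reals.
From mathcomp Require boolp.
From mathcomp Require Import sequences exp ring lra zify.

Set Implicit Arguments.
Unset Strict Implicit.
Unset Printing Implicit Defensive.

Import Order.TTheory GRing.Theory Num.Theory.
Local Open Scope ring_scope.

(** * Concavity and product rules for the perspective of [- u ln u] *)

Section PhiFunction.
Context {R : realType}.
Implicit Types a b c d t : R.

(* The perspective of [eta u = - u ln u], that is [c * eta (a / c)]: it is
   homogeneous of degree 1, so that conditional entropies can be computed
   without normalizing. *)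
Definition phi a c : R := a * ln (c / a).

Lemma phi0 c : phi 0 c = 0. Proof. by rewrite /phi mul0r. Qed.

Lemma phi_ge0 a c : 0 <= a <= c -> 0 <= phi a c.
Proof.
case/andP; rewrite le_eqVlt => /predU1P[<-|a0] ac; first by rewrite phi0.
by rewrite mulr_ge0 ?(ltW a0)// ln_ge0// ler_pdivlMr// mul1r.
Qed.

Lemma phi_diag a : phi a a = 0.
Proof.
rewrite /phi; have [->|a0] := eqVneq a 0; first by rewrite mul0r.
by rewrite divff// ln1 mulr0.
Qed.

Lemma phi_scale b a c : phi (b * a) (b * c) = b * phi a c.
Proof.
rewrite /phi; have [->|b0] := eqVneq b 0; first by rewrite !mul0r.
by rewrite -mulf_div divff// mul1r mulrA.
Qed.

(* The tangent line bound for [ln] at [t]; the bound is attained at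
   [t = c / a]. *)
Lemma phi_le_tangent t a c : 0 < t -> 0 <= a <= c ->
  phi a c <= a * ln t + c / t - a.
Proof.
move=> t0 /andP[]; rewrite le_eqVlt => /predU1P[<-|a0] ac.
  by rewrite phi0 mul0r add0r subr0 divr_ge0// ltW.
have c0 : 0 < c by exact: lt_le_trans ac.
have y0 : 0 < c / a / t by rewrite !divr_gt0.
have := expR_ge1Dx (ln (c / a / t)).
rewrite lnK ?posrE// ln_div ?posrE ?divr_gt0// => le.
rewrite /phi -subr_ge0.
have -> : a * ln t + c / t - a - a * ln (c / a) =
  a * (c / a / t - (1 + (ln (c / a) - ln t))).
  by field; rewrite !gt_eqF.
by rewrite mulr_ge0 ?(ltW a0)// subr_ge0.
Qed.

(** The tangent bounds for the two summands, taken at the common slope [t = (c + d) / (a + b)], add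
    up to the exact value for the sum. *)
Lemma phi_superadd a c b d : 0 <= a <= c -> 0 <= b <= d ->
  phi a c + phi b d <= phi (a + b) (c + d).
Proof.
move=> /andP[a0 ac] /andP[b0 bd].
have [ab0|ab0] := eqVneq (a + b) 0.
  move/eqP: ab0; rewrite paddr_eq0// => /andP[/eqP-> /eqP->].
  by rewrite addr0 !phi0 addr0.
have ab_gt0 : 0 < a + b by rewrite lt_def ab0 addr_ge0.
have cd_gt0 : 0 < c + d by apply: lt_le_trans ab_gt0 _; exact: lerD.
set t := (c + d) / (a + b).
have t0 : 0 < t by rewrite divr_gt0.
have ct : (c + d) / t = a + b by rewrite /t; field; rewrite !gt_eqF.
have h1 : phi a c <= a * ln t + c / t - a by rewrite phi_le_tangent ?a0.
have h2 : phi b d <= b * ln t + d / t - b by rewrite phi_le_tangent ?b0.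
rewrite mulrDl in ct.
rewrite [leRHS]/phi -/t.
lra.
Qed.

Lemma phi_mul a c b d : 0 <= a <= c -> 0 <= b <= d ->
  phi (a * b) (c * d) = b * phi a c + a * phi b d.
Proof.
move=> /andP[]; rewrite le_eqVlt => /predU1P[<- _ _|a0 ac].
  by rewrite mul0r !phi0 mul0r mulr0 addr0.
move=> /andP[]; rewrite le_eqVlt => /predU1P[<- _|b0 bd].
  by rewrite mulr0 !phi0 mul0r mulr0 addr0.
have c0 := lt_le_trans a0 ac; have d0 := lt_le_trans b0 bd.
rewrite /phi -mulf_div (@lnM _ (c / a)) ?posrE ?divr_gt0//; ring.
Qed.

(* [c d - a b = b (c - a) + c (d - b)], and likewise with the roles of the two
   factors exchanged; average the two bounds given by superadditivity. *)
Lemma phi_mul_compl a c b d : 0 <= a <= c -> 0 <= b <= d ->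
  (b * phi (c - a) c + a * phi (d - b) d) / 2 <= phi (c * d - a * b) (c * d).
Proof.
have half x y z w : 0 <= x <= y -> 0 <= z <= w ->
    z * phi (y - x) y <= phi (y * w - x * z) (y * w).
  move=> /andP[x0 xy] /andP[z0 zw].
  have y0 := le_trans x0 xy.
  have /(_ (y * (w - z)) (y * (w - z))) :=
    @phi_superadd (z * (y - x)) (z * y).
  rewrite phi_diag phi_scale addr0.
  have -> : z * (y - x) + y * (w - z) = y * w - x * z by ring.
  have -> : z * y + y * (w - z) = y * w by ring.
  apply.
    by rewrite mulr_ge0 ?subr_ge0//= ler_wpM2l// lerBlDr lerDl.
  by rewrite lexx andbT mulr_ge0// subr_ge0.
move=> ac bd; have h1 := half _ _ _ _ ac bd; have h2 := half _ _ _ _ bd ac.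
rewrite (mulrC d c) (mulrC b a) in h2.
lra.
Qed.

End PhiFunction.

(** * Entropy revealed one event at a time *)

Section PartitionEntropy.
Context {R : realType} {I : finType}.
Implicit Types (f g : I -> R) (E : {set I}) (s : seq {set I}).

Definition mass f : R := \sum_i f i.

Definition restr E f : I -> R := fun i => if i \in E then f i else 0.

(* The entropy of [f], times the mass of [f], with respect to the partition of
   [I] generated by the members of [s], unfolded by the chain rule. *)
Fixpoint entropy s f : R :=
  if s is E :: s' then
    phi (mass (restr E f)) (mass f) + phi (mass (restr (~: E) f)) (mass f) +
    (entropy s' (restr E f) + entropy s' (restr (~: E) f))
  else 0.

Lemma massD f g : mass (f \+ g) = mass f + mass g.
Proof. exact: big_split. Qed.

Lemma mass_ge0 f : (forall i, 0 <= f i) -> 0 <= mass f.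
Proof. by move=> f0; apply: sumr_ge0. Qed.

Lemma restr_ge0 E f : (forall i, 0 <= f i) -> forall i, 0 <= restr E f i.
Proof. by move=> f0 i; rewrite /restr; case: ifP. Qed.

Lemma mass_restrE E f : mass (restr E f) = \sum_(i in E) f i.
Proof. by rewrite [RHS]big_mkcond. Qed.

Lemma mass_restrC E f : mass (restr E f) + mass (restr (~: E) f) = mass f.
Proof.
rewrite -massD; apply: eq_bigr => i _.
by rewrite /restr /= inE; case: (i \in E); rewrite ?addr0 ?add0r.
Qed.

Lemma mass_restr_le E f : (forall i, 0 <= f i) ->
  0 <= mass (restr E f) <= mass f.
Proof.
move=> f0; rewrite -(mass_restrC E f) lerDl.
by rewrite !mass_ge0//; exact: restr_ge0.
Qed.

Lemma restrD E f g : restr E (f \+ g) = restr E f \+ restr E g.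
Proof.
by apply: boolp.funext => i; rewrite /restr/=; case: ifP; rewrite ?addr0.
Qed.

Lemma restr_comm E E' f : restr E (restr E' f) = restr E' (restr E f).
Proof. by apply: boolp.funext => i; rewrite /restr; do 2?case: ifP. Qed.

Lemma entropy_superadd s f g :
  (forall i, 0 <= f i) -> (forall i, 0 <= g i) ->
  entropy s f + entropy s g <= entropy s (f \+ g).
Proof.
elim: s f g => [|E s IH] f g f0 g0 /=; first by rewrite addr0.
have fE := restr_ge0 _ f0; have gE := restr_ge0 _ g0.
rewrite !restrD !massD.
have h1 := phi_superadd (mass_restr_le E f0) (mass_restr_le E g0).
have h2 := phi_superadd (mass_restr_le (~: E) f0) (mass_restr_le (~: E) g0).
have h3 := IH _ _ (fE E) (gE E).
have h4 := IH _ _ (fE (~: E)) (gE (~: E)).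
lra.
Qed.

(** Separation is only asked on the support of [f], so that it survives the induction: after
    restriction to [E] or its complement, [E] distinguishes no two points of the support. *)
Lemma entropy_separated s f :
  (forall i, 0 <= f i) ->
  (forall i j, 0 < f i -> 0 < f j -> {in s, forall E, (i \in E) = (j \in E)} ->
    i = j) ->
  entropy s f = \sum_i phi (f i) (mass f).
Proof.
elim: s f => [|E s IH] f f0 sep /=.
  have [[i fi]|fz] := boolp.pselect (exists i, 0 < f i); last first.
    rewrite big1// => i _; have := f0 i; rewrite le_eqVlt => /predU1P[<-|fi].
      by rewrite phi0.
    by case: fz; exists i.
  have fj j : j != i -> f j = 0.
    move=> ji; have := f0 j; rewrite le_eqVlt => /predU1P[//|fj].
    by move/eqP: ji; case; exact: sep.
  have -> : mass f = f i by rewrite /mass (bigD1 i)//= big1 ?addr0.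
  by rewrite (bigD1 i)//= phi_diag add0r big1// => j /fj ->; rewrite phi0.
have restr_pos E' i : 0 < restr E' f i -> i \in E' /\ 0 < f i.
  by rewrite /restr; case: ifP => //; rewrite ltxx.
rewrite !IH; [|exact: restr_ge0| |exact: restr_ge0|]; last 2 first.
- move=> i j /restr_pos[iE fi] /restr_pos[jE fj] h; apply: sep => // E'.
  rewrite inE => /predU1P[->|/h//].
  by move: iE jE; rewrite !inE => /negPf-> /negPf->.
- move=> i j /restr_pos[iE fi] /restr_pos[jE fj] h; apply: sep => // E'.
  by rewrite inE => /predU1P[->|/h//]; rewrite iE jE.
(* Chain rule: the logarithms of [mass f / mass (restr E' f)] and [mass (restr E' f) / f i] add
   up. *)
have chain E' : phi (mass (restr E' f)) (mass f) +
    \sum_i phi (restr E' f i) (mass (restr E' f)) =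
    \sum_i phi (restr E' f i) (mass f).
  rewrite {1}/phi {1}/mass mulr_suml -big_split/=; apply: eq_bigr => i _.
  have := restr_ge0 E' f0 i.
  rewrite le_eqVlt => /predU1P[<-|gi0]; first by rewrite mul0r !phi0 addr0.
  have m0 : 0 < mass (restr E' f).
    rewrite (lt_le_trans gi0)// [leRHS]/mass (bigD1 i)//= lerDl.
    by rewrite sumr_ge0// => j _; exact: restr_ge0.
  have c0 : 0 < mass f.
    by rewrite (lt_le_trans m0)//; case/andP: (mass_restr_le E' f0).
  by rewrite /phi !ln_div ?posrE//; ring.
rewrite addrACA !chain -big_split/=; apply: eq_bigr => i _.
by rewrite /restr inE; case: (i \in E); rewrite phi0 ?addr0 ?add0r.
Qed.

(* The contribution of [f] to the lower bound on the entropy of [conv f g]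
   below, where [al E] will be the mass that [g] gives to [E]; the factors 1 and
   1/2 are those of [phi_mul] and [phi_mul_compl].  Linearity in [al] makes the
   induction there go through. *)
Fixpoint weighted_entropy (al : {set I} -> R) s f : R :=
  if s is E :: s' then
    al E * (phi (mass (restr E f)) (mass f) +
            phi (mass (restr (~: E) f)) (mass f) / 2) +
    (weighted_entropy al s' (restr E f) +
     weighted_entropy al s' (restr (~: E) f))
  else 0.

Lemma weighted_entropyD al be s f :
  weighted_entropy (al \+ be) s f =
  weighted_entropy al s f + weighted_entropy be s f.
Proof.
by elim: s f => [|E s IH] f /=; [rewrite addr0 | rewrite !IH; ring].
Qed.

(** At each event, doubling covers the [E] term since [2 * al E >= 1], and leaves a deficit
    [1 - al E] on the complement term, which is at most [mass f / e] by the tangent at [e]. *)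
Lemma weighted_entropy_ge al s f : (forall i, 0 <= f i) ->
  {in s, forall E, 1 / 2 <= al E <= 1} ->
  entropy s f - mass f * expR (- 1) * \sum_(E <- s) (1 - al E) <=
  2 * weighted_entropy al s f.
Proof.
elim: s f => [|E s IH] f f0 hal /=; first by rewrite big_nil !mulr0 subr0.
have hs : {in s, forall E, 1 / 2 <= al E <= 1}.
  by move=> E' E's; apply: hal; rewrite inE E's orbT.
have h1 := IH _ (restr_ge0 E f0) hs.
have h2 := IH _ (restr_ge0 (~: E) f0) hs.
have /andP[a1 a2] := hal E (mem_head _ _).
have x0 := phi_ge0 (mass_restr_le E f0).
have ybnd : phi (mass (restr (~: E) f)) (mass f) <= mass f * expR (- 1).
  have := phi_le_tangent (expR_gt0 1) (mass_restr_le (~: E) f0).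
  by rewrite expRK mulr1 addrAC subrr add0r expRN.
rewrite big_cons -(mass_restrC E f) in x0 ybnd *.
set X := phi (mass (restr E f)) _ in x0 *.
set Y := phi (mass (restr (~: E) f)) _ in ybnd *.
have : 0 <= (2 * al E - 1) * X by rewrite mulr_ge0//; lra.
have : 0 <= (1 - al E) *
    ((mass (restr E f) + mass (restr (~: E) f)) * expR (- 1) - Y).
  by rewrite mulr_ge0 ?subr_ge0.
move: h1 h2; lra.
Qed.

(** * Entropy of the meet of two independent variables *)

Variable meet : I -> I -> I.

(* The law of the meet of independent variables with laws [f] and [g]. *)
Definition conv f g : I -> R :=
  fun i => \sum_(p : I * I | meet p.1 p.2 == i) f p.1 * g p.2.

Definition meet_stable E :=
  forall i j, (meet i j \in E) = (i \in E) && (j \in E).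

Lemma conv_ge0 f g : (forall i, 0 <= f i) -> (forall i, 0 <= g i) ->
  forall i, 0 <= conv f g i.
Proof. by move=> f0 g0 i; apply: sumr_ge0 => p _; rewrite mulr_ge0. Qed.

Lemma mass_conv f g : mass (conv f g) = mass f * mass g.
Proof.
rewrite /mass /conv big_distrlr/= pair_big/=.
by rewrite (partition_big (fun p => meet p.1 p.2) xpredT).
Qed.

Lemma restr_conv E f g : meet_stable E ->
  restr E (conv f g) = conv (restr E f) (restr E g).
Proof.
move=> stab; apply: boolp.funext => i; rewrite /restr /conv.
case: ifPn => iE.
  apply: eq_bigr => p /eqP pi; move: iE; rewrite -pi stab => /andP[-> ->] //.
rewrite big1// => p /eqP pi; move: iE; rewrite -pi stab.
by case: (_ \in E) => //=; case: (_ \in E) => //=; rewrite ?mulr0 ?mul0r.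
Qed.

Lemma restrC_conv E f g : meet_stable E ->
  restr (~: E) (conv f g) = conv (restr E f) (restr (~: E) g) \+
    (conv (restr (~: E) f) (restr E g) \+
     conv (restr (~: E) f) (restr (~: E) g)).
Proof.
move=> stab; apply: boolp.funext => i; rewrite /restr /conv/= -!big_split/=.
rewrite inE; case: ifPn => iE.
  apply: eq_bigr => p /eqP pi; move: iE; rewrite -pi stab !inE.
  by do 2 case: (_ \in E) => //=; rewrite ?(mulr0, mul0r, addr0, add0r).
rewrite big1// => p /eqP pi; move: iE; rewrite -pi stab negbK !inE.
by move=> /andP[-> ->] /=; rewrite !(mulr0, mul0r, addr0).
Qed.

(** Splitting [f] and [g] along [E] gives four products. Only the one inside [E] stays in [E]; the
    other three merge in the complement, where superadditivity applies. The four induction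
    hypotheses recombine because the weights are additive. *)
Lemma weighted_entropy_le_conv s f g :
  (forall i, 0 <= f i) -> (forall i, 0 <= g i) ->
  {in s, forall E, meet_stable E} ->
  weighted_entropy (fun E => mass (restr E g)) s f +
  weighted_entropy (fun E => mass (restr E f)) s g <= entropy s (conv f g).
Proof.
elim: s f g => [|E s IH] f g f0 g0 stab /=; first by rewrite addr0.
have stabE := stab _ (mem_head _ _).
have stabs : {in s, forall E, meet_stable E}.
  by move=> E' E's; apply: stab; rewrite inE E's orbT.
have fE := restr_ge0 E f0; have gE := restr_ge0 E g0.
have fC := restr_ge0 (~: E) f0; have gC := restr_ge0 (~: E) g0.
have marg f' : (fun E' => mass (restr E' f')) =
    (fun E' => mass (restr E' (restr E f'))) \+
    (fun E' => mass (restr E' (restr (~: E) f'))).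
  apply: boolp.funext => E' /=.
  by rewrite !(restr_comm E') mass_restrC.
have h11 := IH _ _ fE gE stabs.
have h10 := IH _ _ fE gC stabs.
have h01 := IH _ _ fC gE stabs.
have h00 := IH _ _ fC gC stabs.
have sup1 := entropy_superadd s (conv_ge0 fE gC)
  (fun i => addr_ge0 (conv_ge0 fC gE i) (conv_ge0 fC gC i)).
have sup2 := entropy_superadd s (conv_ge0 fC gE) (conv_ge0 fC gC).
have mC : mass (restr (~: E) (conv f g)) =
    mass f * mass g - mass (restr E f) * mass (restr E g).
  rewrite -(mass_conv f g) -(mass_conv (restr E f)) -restr_conv//.
  by rewrite -(mass_restrC E (conv f g)) addrC addKr.
rewrite mC restr_conv// restrC_conv// !mass_conv.
have mf := mass_restr_le E f0; have mg := mass_restr_le E g0.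
have c1 := phi_mul mf mg; have c0 := phi_mul_compl mf mg.
have compl f' : mass (restr (~: E) f') = mass f' - mass (restr E f').
  by rewrite -(mass_restrC E f') addrC addKr.
rewrite !compl c1 (marg f) (marg g) !weighted_entropyD /=.
lra.
Qed.

End PartitionEntropy.

(** * The maximum entropy argument for an abstract meet operation *)

Lemma sum_count_mass (R : realType) (I : finType) (s : seq {set I})
    (g : I -> R) :
  \sum_i g i * (count (fun E : {set I} => i \in E) s)%:R =
  \sum_(E <- s) mass (restr E g).
Proof.
rewrite exchange_big/=; apply: eq_bigr => i _.
rewrite -sum1_count natr_sum mulr_sumr big_mkcond/=; apply: eq_bigr => E _.
by rewrite /restr mulr1.
Qed.

Lemma exists_half_avoided (R : realType) (I : finType) (meet : I -> I -> I)
    (s : seq {set I}) (lam : R) :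
  {in s, forall E, meet_stable meet E} ->
  (forall i j, {in s, forall E : {set I}, (i \in E) = (j \in E)} -> i = j) ->
  (1 < #|I|)%N -> 0 < lam -> 2 * expR (- 1) < - ln lam ->
  let w i := lam ^+ count (fun E : {set I} => i \in E) s in
  exists2 E, E \in s & (\sum_i w i) / 2 <= \sum_(i | i \notin E) w i.
Proof.
move=> stab sep I2 lam0 hlam w.
set Z := \sum_i w i.
have [/hasP[E Es hE]|/hasPn hs] :=
  boolP (has (fun E : {set I} => Z / 2 <= \sum_(i | i \notin E) w i) s);
  first by exists E.
exfalso.
have w0 i : 0 < w i by rewrite exprn_gt0.
have [i0 [j0 [_ _ ij0]]] : exists i j, [/\ i \in I, j \in I & i != j].
  by apply/card_gt1P.
have Z0 : 0 < Z.
  rewrite /Z (bigD1 i0)//= ltr_pwDl// sumr_ge0// => i _; exact: ltW.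
pose f i := w i / Z.
have f_gt0 i : 0 < f i by rewrite divr_gt0.
have f0 i : 0 <= f i by exact: ltW.
have mf : mass f = 1 by rewrite /mass -mulr_suml divff// gt_eqF.
pose h := conv meet f f.
have h0 : forall i, 0 <= h i by exact: conv_ge0.
have mh : mass h = 1 by rewrite mass_conv mf mulr1.
pose m E := mass (restr E f).
have m_half E : E \in s -> 1 / 2 < m E <= 1.
  move=> Es; have /andP[_] := mass_restr_le E f0; rewrite mf -/(m E) => ->.
  have := hs _ Es; rewrite -ltNge.
  have -> : \sum_(i | i \notin E) w i = (1 - m E) * Z.
    rewrite -mf -(mass_restrC E f) addrAC subrr add0r mass_restrE mulr_suml.
    by apply: eq_big => i; rewrite ?inE// => _; rewrite divfK// gt_eqF.
  rewrite -ltr_pdivlMr// mulrAC divff ?gt_eqF// andbT; lra.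
(* The cross entropy of [g] relative to [f] depends on [g] only through its marginals. *)
have cross g : mass g = 1 -> \sum_i g i * ln (f i)^-1 =
    ln Z - ln lam * \sum_(E <- s) mass (restr E g).
  move=> mg; have -> : ln Z = mass g * ln Z by rewrite mg mul1r.
  rewrite -sum_count_mass mulr_sumr mulr_suml -sumrB.
  apply: eq_bigr => i _.
  rewrite /f invf_div ln_div ?posrE// /w lnXn// -[ln lam *+ _]mulr_natr; ring.
have ent_f : entropy s f = ln Z - ln lam * \sum_(E <- s) m E.
  rewrite entropy_separated// => [|i j _ _]; last exact: sep.
  by rewrite -cross// mf; apply: eq_bigr => i _; rewrite /phi div1r.
(* Gibbs' inequality, from tangents at [(f i)^-1]; the marginals of [h] are squares by
   independence. *)
have ent_h : entropy s h <= ln Z - ln lam * \sum_(E <- s) m E ^+ 2.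
  rewrite entropy_separated// => [|i j _ _]; last exact: sep.
  have -> : \sum_(E <- s) m E ^+ 2 = \sum_(E <- s) mass (restr E h).
    rewrite !big_seq; apply: eq_bigr => E Es.
    by rewrite restr_conv ?mass_conv//; exact: stab.
  rewrite -cross// mh.
  apply: (@le_trans _ _ (\sum_i (h i * ln (f i)^-1 + f i - h i))).
    apply: ler_sum => i _; have := @phi_le_tangent _ (f i)^-1 (h i) 1.
    rewrite invr_gt0 f_gt0 div1r invrK h0 => /(_ isT); apply.
    by rewrite -mh /mass (bigD1 i)//= lerDl sumr_ge0.
  by rewrite sumrB big_split/= -/(mass f) -/(mass h) mf mh addrK.
have al : {in s, forall E, 1 / 2 <= m E <= 1}.
  by move=> E /m_half/andP[/ltW -> ->].
have := le_trans (weighted_entropy_ge f0 al) _.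
move=> /(_ (entropy s h)); rewrite -/m mf.
have := weighted_entropy_le_conv f0 f0 stab.
rewrite -/m -/h => low /(_ _) low'.
have {low low'} : entropy s f - 1 * expR (- 1) * \sum_(E <- s) (1 - m E) <=
    entropy s h by apply: low'; move: low; lra.
apply/negP; rewrite -ltNge; apply: le_lt_trans ent_h _.
rewrite ent_f.
(* The energy gain [m E - m E ^+ 2] and the entropy loss share the factor [1 - m E]. *)
suff : 0 < \sum_(E <- s) (1 - m E) * (- ln lam * m E - expR (- 1)).
  have -> : \sum_(E <- s) (1 - m E) * (- ln lam * m E - expR (- 1)) =
    - ln lam * \sum_(E <- s) m E + ln lam * \sum_(E <- s) m E ^+ 2 -
    expR (- 1) * \sum_(E <- s) (1 - m E).
    rewrite !mulr_sumr -big_split -sumrB/=; apply: eq_bigr => E _; ring.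
  lra.
(* Strictness needs an event with [m E < 1]: one that separates two points of [I] misses one of
   them. *)
have [E Es Eij] : exists2 E, E \in s & (i0 \in E) != (j0 \in E).
  apply/hasP; apply: contraNT ij0 => /hasPn nE; apply/eqP/sep => E Es.
  by apply/eqP; have := nE _ Es; rewrite negbK.
have hpos E' : E' \in s -> 0 < - ln lam * m E' - expR (- 1).
  move=> /m_half/andP[m1 _]; have := expR_gt0 (- 1 : R) => e0.
  have : 0 < (- ln lam - 2 * expR (-1)) * m E'.
    by rewrite mulr_gt0 ?subr_gt0//; lra.
  have : 0 < expR (-1) * (m E' - 1 / 2) by rewrite mulr_gt0 ?subr_gt0.
  lra.
rewrite (big_rem E)//= ltr_pwDl//.
  rewrite mulr_gt0 ?hpos// subr_gt0 -mf -(mass_restrC E f) ltrDl mass_restrE.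
  have [k kE] : exists k, k \in ~: E.
    move: Eij; have [j0E|j0E _] := boolP (j0 \in E).
      by rewrite eqb_id => iE; exists i0; rewrite inE.
    by exists j0; rewrite inE.
  by rewrite (bigD1 k)//= ltr_pwDl// sumr_ge0.
rewrite big_seq sumr_ge0// => E' /mem_rem E's.
by rewrite mulr_ge0 ?(ltW (hpos _ E's))// subr_ge0; case/andP: (m_half _ E's).
Qed.

(** * Numerical bounds and the return to set families *)

Lemma expR_ge_expn (R : realType) (n : nat) (x : R) : -1 <= x ->
  (1 + x) ^+ n <= expR (n%:R * x).
Proof.
move=> x1; rewrite expRM_natl lerXn2r ?nnegrE ?expR_ge0 ?expR_ge1Dx//; lra.
Qed.

(** The value 4/5 lies between the two sides: [5/2 <= (7/6)^6 <= e] and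
    [2/5 < (9/10)^8 <= e^(-4/5)]. *)
Lemma ln_two_fifths (R : realType) (lam : R) : 0 < lam -> lam <= 2 / 5 ->
  2 * expR (- 1) < - ln lam.
Proof.
move=> lam0 lam1.
have e1 : expR (- 1) <= (2 / 5 : R).
  rewrite expRN -[2 / 5]invrK lef_pV2 ?posrE ?expR_gt0 ?invr_gt0//; last by lra.
  have /(_ (1 / 6)) := @expR_ge_expn R 6.
  have -> : 6%:R * (1 / 6) = 1 :> R by field.
  by move=> h; apply: (le_trans _ (h _)); lra.
have e2 : lam < expR (- (4 / 5)).
  have /(_ (- (1 / 10))) := @expR_ge_expn R 8.
  have -> : 8%:R * - (1 / 10) = - (4 / 5) :> R by field.
  by move=> h; apply: (lt_le_trans _ (h _)); lra.
have : ln lam < - (4 / 5).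
  by rewrite -[ltRHS]expRK ltr_ln ?posrE ?expR_gt0.
lra.
Qed.

Theorem corollary1p4 (R : realType) (T : choiceType) (k m : nat)
    (F : {fset {fset T}}) :
  (5 <= k)%N ->
  (1 <= m)%N ->
  m%:R <= Num.sqrt (k%:R : R) ->
  intersection_closed F ->
  (2 <= #|` F|)%N ->
  exists2 i : T, i \in (\bigcup_(A <- F) A)%fset &
    (\sum_(A <- F | i \notin A) (m%:R / k%:R : R) ^+ #|` A|)
      / (\sum_(A <- F) (m%:R / k%:R : R) ^+ #|` A|) >= 1 / 2.
Proof.
move=> k5 m1 mk Fcap F2.
set lam := m%:R / k%:R.
have k0 : 0 < k%:R :> R by rewrite ltr0n; lia.
have lam0 : 0 < lam by rewrite divr_gt0// ltr0n.
have lam1 : lam <= 2 / 5.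
  have mk2 : (m * m <= k)%N.
    rewrite -(ler_nat R) natrM -expr2 -(sqr_sqrtr (ltW k0)).
    by rewrite lerXn2r// ?nnegrE ?sqrtr_ge0.
  (* For [m <= 2] this is [k >= 5]; for [m >= 3] it follows from [m * m <= k]. *)
  have : (5 * m <= 2 * k)%N by nia.
  rewrite -(ler_nat R) !natrM => mk3.
  by rewrite /lam ler_pdivrMr//; lra.
pose U := (\bigcup_(A <- F) A)%fset.
have FU A : A \in F -> (A `<=` U)%fset by move=> AF; exact: bigfcup_sup.
pose meet (A B : F) : F := [` Fcap _ _ (valP A) (valP B)]%fset.
pose event x : {set F} := [set A : F | x \in val A].
(* One event per element of [U], so that counting the events containing [A] gives the size of
   [A]. *)
pose s := [seq event x | x <- enum_fset U].
have cnt (A : F) : count (fun E : {set F} => A \in E) s = #|` val A|.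
  rewrite /s count_map -size_filter; apply/perm_size/uniq_perm => //.
    exact/filter_uniq.
  move=> x; rewrite mem_filter /= inE.
  by apply: andb_idr; exact/fsubsetP/FU/valP.
have [|||||E /mapP[x xU ->]] := @exists_half_avoided R F meet s lam.
- by move=> _ /mapP[x _ ->] A B; rewrite !inE/= ?inE.
- move=> A B AB; apply/val_inj/fsetP => x.
  have [xU|xU] := boolP (x \in U).
    by have := AB _ (map_f event xU); rewrite !inE.
  have out (C : F) : x \in val C = false.
    by apply: contraNF xU; exact/fsubsetP/FU/valP.
  by rewrite !out.
- by rewrite -cardfE.
- exact: lam0.
- exact: ln_two_fifths.
rewrite /=; under eq_bigr do rewrite cnt.
under [X in _ <= X -> _]eq_bigr do rewrite cnt.
under [X in _ <= X -> _]eq_bigl do rewrite inE.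
move=> le; exists x => //.
rewrite !big_seq_fsetE/= ler_pdivlMr; first by rewrite mulrC mulrA mulr1.
have [A AF] : exists A, A \in F by apply/fset0Pn; rewrite -cardfs_gt0 ltnW.
rewrite (bigD1 [` AF]%fset)//= ltr_pwDl ?exprn_gt0//.
by rewrite sumr_ge0// => B _; rewrite exprn_ge0// ltW.
Qed.
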